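(* Let $G$ be a bipartite graph with left vertex set $[n]$ and right vertex set $[m]$ such that $N_G([m])=[n]$ (every left vertex has a neighbor). If $M$ is a matroid on $[n]$, then $$J_{\mathrm{Ind}_G(M)}=\mathrm{Ret}_{\mathbf 1}\big(\mathrm{Ind}_G(J_M)\big),$$ where $\mathbf 1\in\mathbb{Z}_{\ge 0}^m$ is the all-ones vector.
   Context: Let $[n]=\{1,\dots,n\}$. For a matroid $N$ on $[k]$, $J_N=\{\mathbf 1_B: B\text{ a basis of }N\}\subseteq\{0,1\}^k$ is the set of indicator vectors of its bases. Regard $E(G)\subseteq[n]\times[m]$. For $A\subseteq[m]$, $N_G(A)=\{i\in[n]: (i,j)\in E(G)\text{ for some }j\in A\}$. For $w\in\mathbb{Z}_{\ge0}^{E(G)}$ (extended by zero to $[n]\times[m]$) put $d_L(w)_i=\sum_{j\in[m]}w_{ij}$ for $i\in[n]$ and $d_R(w)_j=\sum_{i\in[n]}w_{ij}$ for $j\in[m]$. For $J\subseteq\mathbb{Z}_{\ge0}^n$ an M-convex set (such as $J_M$), the induction of $J$ along $G$ is $\mathrm{Ind}_G(J)=\{d_R(w): w\in\mathbb{Z}_{\ge0}^{E(G)},\ d_L(w)\in J\}\subseteq\mathbb{Z}_{\ge0}^m$. For $\kappa\in\mathbb{Z}_{\ge0}^m$ and $K\subseteq\mathbb{Z}_{\ge0}^m$, $\mathrm{Ret}_\kappa(K)$ is the set of coordinatewise maximal elements of $\{(\min(\alpha_j,\kappa_j))_{j}:\alpha\in K\}$. For a matroid $M$ on $[n]$, the matroid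 $\mathrm{Ind}_G(M)$ on $[m]$ induced from $M$ by $G$ is the matroid whose independent sets are the $X\subseteq[m]$ that can be matched in $G$ to an independent set of $M$ (i.e. there is a matching of $G$ whose set of right endpoints is $X$ and whose set of left endpoints is an independent set of $M$). *)

(* Defs.v *)
From mathcomp Require Import all_boot.
From mathcomp Require Import classical_sets.

Set Implicit Arguments.
Unset Strict Implicit.
Unset Printing Implicit Defensive.

(* A subset of the ground set is a finite set [{set T}] (set_scope, %SET);
   a set of vectors is a possibly infinite [set _] (classical_set_scope). *)

Record matroid (T : finType) := Matroid {
  indep : pred {set T};
  indep0 : indep finset.set0;
  indepS : forall A B : {set T}, A \subset B -> indep B -> indep A;
  indep_aug : forall A B : {set T}, indep A -> indep B -> (#|A| < #|B|)%N ->
    exists2 x, x \in (B :\: A)%SET & indep (x |: A)%SET }.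

Definition basis (T : finType) (N : matroid T) (B : {set T}) : bool :=
  maxset (indep N) B.

Definition vec (k : nat) := {ffun 'I_k -> nat}.

Definition vle (k : nat) (a b : vec k) : bool := [forall j, a j <= b j].

Definition ones (k : nat) : vec k := [ffun=> 1].

Definition indicator (k : nat) (B : {set 'I_k}) : vec k :=
  [ffun i => nat_of_bool (i \in B)].

Definition basis_vectors (k : nat) (N : matroid 'I_k) : set (vec k) :=
  [set v | exists2 B : {set 'I_k}, basis N B & v = indicator B]%classic.

(* The bipartite graph with sides 'I_n and 'I_m is given by its edge set. *)
Definition bigraph (n m : nat) := {set 'I_n * 'I_m}.

Definition left_nbrs (n m : nat) (G : bigraph n m) (A : {set 'I_m}) :
    {set 'I_n} :=
  [set i | [exists j in A, (i, j) \in G]]%SET.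

Definition degL (n m : nat) (w : {ffun 'I_n * 'I_m -> nat}) : vec n :=
  [ffun i => \sum_(j < m) w (i, j)].

Definition degR (n m : nat) (w : {ffun 'I_n * 'I_m -> nat}) : vec m :=
  [ffun j => \sum_(i < n) w (i, j)].

Definition induction (n m : nat) (G : bigraph n m) (J : set (vec n)) :
    set (vec m) :=
  [set v | exists w : {ffun 'I_n * 'I_m -> nat},
     [/\ forall e, e \notin G -> w e = 0, J (degL w) & v = degR w]]%classic.

Definition truncation (m : nat) (kappa : vec m) (K : set (vec m)) :
    set (vec m) :=
  [set v | exists2 a, K a & v = [ffun j => minn (a j) (kappa j)]]%classic.

Definition retract (m : nat) (kappa : vec m) (K : set (vec m)) :
    set (vec m) :=
  [set v | truncation kappa K v /\
     forall u, truncation kappa K u -> vle v u -> u = v]%classic.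

Definition matching (n m : nat) (G : bigraph n m) (F : {set 'I_n * 'I_m}) :
    bool :=
  (F \subset G) &&
  [forall e in F, forall f in F,
     ((e.1 == f.1) || (e.2 == f.2)) ==> (e == f)].

Definition induced_indep (n m : nat) (G : bigraph n m) (M : matroid 'I_n) :
    pred {set 'I_m} :=
  fun X => [exists F : {set 'I_n * 'I_m},
    [&& matching G F, (snd @: F)%SET == X & indep M (fst @: F)%SET]].

Section InducedMatroid.
Variables (n m : nat) (G : bigraph n m) (M : matroid 'I_n).
Local Open Scope set_scope.

Lemma matchingP (F : {set 'I_n * 'I_m}) :
  reflect [/\ F \subset G, {in F &, injective fst} & {in F &, injective snd}]
          (matching G F).
Proof.
apply: (iffP andP) => [[sFG /forall_inP mF]|[sFG i1 i2]]; split=> //.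
- move=> e f eF fF ef; apply/eqP.
  by have /forall_inP/(_ f fF) := mF e eF; rewrite ef eqxx.
- move=> e f eF fF ef; apply/eqP.
  by have /forall_inP/(_ f fF) := mF e eF; rewrite ef eqxx orbT.
apply/forall_inP => e eF; apply/forall_inP => f fF; apply/implyP.
by case/orP=> /eqP ef; apply/eqP; [exact: i1 | exact: i2].
Qed.

Lemma matchingS (F H : {set 'I_n * 'I_m}) :
  F \subset H -> matching G H -> matching G F.
Proof.
move=> sFH /matchingP[sHG i1 i2]; apply/matchingP.
split; first exact: fintype.subset_trans sHG.
  by apply: sub_in2 i1; apply/fintype.subsetP.
by apply: sub_in2 i2; apply/fintype.subsetP.
Qed.

Lemma induced_indep0 : induced_indep G M finset.set0.
Proof.
apply/existsP; exists finset.set0; rewrite !imset0 eqxx indep0 !andbT.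
apply/matchingP; split=> [|e f|e f]; rewrite ?finset.in_set0 //; exact: finset.sub0set.
Qed.

Lemma induced_indepS (A B : {set 'I_m}) :
  A \subset B -> induced_indep G M B -> induced_indep G M A.
Proof.
move=> sAB /existsP[F /and3P[mF /eqP FB iF]].
pose F' := [set e in F | e.2 \in A].
have sF : F' \subset F by apply/fintype.subsetP => e; rewrite inE => /andP[].
apply/existsP; exists F'; apply/and3P; split.
- exact: matchingS mF.
- apply/eqP/setP => j; apply/imsetP/idP => [[e]|jA].
    by rewrite inE => /andP[_ eA] ->.
  have := fintype.subsetP sAB _ jA; rewrite -FB => /imsetP[e eF je].
  by exists e; rewrite // inE eF -je.
- by apply: indepS iF; apply: imsetS.
Qed.

Lemma induced_indep_aug (A B : {set 'I_m}) :
  induced_indep G M A -> induced_indep G M B -> (#|A| < #|B|)%N ->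
  exists2 x, x \in B :\: A & induced_indep G M (x |: A).
Proof.
move=> /existsP[F /and3P[mF /eqP FA iF]].
move=> /existsP[H /and3P[mH /eqP HB iH]] ltAB.
have [k] := ubnP (#|H| - #|F :&: H|).
elim: k F mF FA iF => // k IHk F mF FA iF ltk.
have [sFG F1 F2] := matchingP _ mF; have [sHG H1 H2] := matchingP _ mH.
have ltI : (#|fst @: F| < #|fst @: H|)%N.
  by rewrite !card_in_imset // -(card_in_imset F2) -(card_in_imset H2) FA HB.
have [j] := indep_aug iF iH ltI.
rewrite inE => /andP[jF /imsetP[[j' y] eH /= jj']] ijF; subst j'.
pose F' := (j, y) |: [set f in F | f.2 != y].
have jFn f : f \in F -> f.1 != j.
  by move=> fF; apply: contraNneq jF => <-; apply: imset_f.
have mF' : matching G F'.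
  apply/matchingP; split.
  - apply/fintype.subsetP => f; rewrite !inE => /orP[/eqP->|/andP[fF _]].
      exact: (fintype.subsetP sHG).
    exact: (fintype.subsetP sFG).
  - move=> e f; rewrite !inE => /orP[/eqP->|/andP[eF _]] /orP[/eqP->|/andP[fF _]] //=.
    + by move=> jf; have := jFn f fF; rewrite -jf eqxx.
    + by move=> jf; have := jFn e eF; rewrite jf eqxx.
    + exact: F1.
  - move=> e f; rewrite !inE => /orP[/eqP->|/andP[eF ey]] /orP[/eqP->|/andP[fF fy]] //=.
    + by move=> jf; rewrite -jf eqxx in fy.
    + by move=> jf; rewrite jf eqxx in ey.
    + exact: F2.
have iF' : indep M (fst @: F').
  apply: indepS ijF; apply/fintype.subsetP => _ /imsetP[f + ->].
  rewrite !inE => /orP[/eqP->|/andP[fF _]]; first by rewrite eqxx.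
  by rewrite imset_f ?orbT.
have sF' : snd @: F' = y |: A.
  apply/setP => x; rewrite -FA; apply/imsetP/setU1P => [[f]|[->|/imsetP[f fF ->]]].
  - rewrite !inE => /orP[/eqP-> ->|/andP[fF _] ->]; first by left.
    by right; apply: imset_f.
  - by exists (j, y); rewrite // !inE eqxx.
  - have [fy|fy] := eqVneq f.2 y; last by exists f; rewrite // !inE fF fy orbT.
    by exists (j, y); rewrite // !inE eqxx.
have yB : y \in B by rewrite -HB; apply/imsetP; exists (j, y).
have [yA|yA] := boolP (y \in A); last first.
  exists y; first by rewrite inE yA yB.
  by apply/existsP; exists F'; rewrite mF' sF' eqxx.
apply: (IHk F') => //.
  by rewrite sF'; apply/finset.setUidPr; rewrite finset.sub1set.
have pFF' : F :&: H \proper F' :&: H.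
  apply/properP; split.
    apply/fintype.subsetP => f /setIP[fF fH]; rewrite !inE fF fH /= !andbT.
    rewrite orbC -implybE; apply/implyP=> /eqP fy.
    by apply/eqP; apply: H2.
  exists (j, y); first by rewrite !inE eqxx eH.
  by rewrite !inE; apply/negP => /andP[/jFn]; rewrite eqxx.
have := proper_card pFF'.
have := subset_leq_card (finset.subsetIr F' H).
move: ltk; rewrite ltnS => ltk le1 lt2.
apply: leq_trans ltk; apply: ltn_sub2l => //.
exact: leq_trans lt2 le1.
Qed.

Definition induced_matroid : matroid 'I_m :=
  Matroid induced_indep0 induced_indepS induced_indep_aug.

End InducedMatroid.

(* Main.v *)
Require Import Defs.
From mathcomp Require Import all_boot.
From mathcomp Require Import classical_sets.

(** Truncating a vector at the all-ones vector leaves the indicator of its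
    support, so the truncations of the vectors of Ind_G(J_M) are indicators of
    certain subsets of the right side; call these subsets the supports.
    The independent sets of the induced matroid and the supports have the same
    inclusion-maximal members, which is the theorem, because of two facts.

    - Every support is independent ([truncation_induced_indep]): if the left
      degree vector of w is the indicator of a basis, then every left vertex
      carries at most one unit of w, so choosing one edge of positive weight
      at each vertex of the support of the right degree vector gives a
      matching into a subset of that basis.
    - Every independent set lies in a support ([induced_indep_sub_truncation]):
      extend the left end of a matching to a basis B of M, keep the matching
      edges, and send every other vertex of B along an arbitrary edge.  Such
      edges exist because every left vertex has a neighbour. *)

Local Open Scope set_scope.
Set Implicit Arguments.
Unset Strict Implicit.

Lemma indicator_inj k : injective (@indicator k).
Proof.
move=> A B /ffunP eAB; apply/setP => i.
by have := eAB i; rewrite !ffunE; do 2!case: (_ \in _).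
Qed.

Lemma vle_indicator k (A B : {set 'I_k}) :
  vle (indicator A) (indicator B) = (A \subset B).
Proof.
apply/forallP/fintype.subsetP => [le_AB i iA | sAB i].
  by have := le_AB i; rewrite !ffunE iA; case: (i \in B).
by rewrite !ffunE; case: (boolP (i \in A)) => [/sAB -> | _].
Qed.

Lemma truncate_ones k (a : vec k) :
  [ffun j => minn (a j) (ones k j)] = indicator [set j | 0 < a j].
Proof.
by apply/ffunP => j; rewrite !ffunE inE; case: (a j) => //= x; rewrite minnSS minn0.
Qed.

(** If the left degree vector is a 0/1 vector, two edges of positive weight
    with a common left end would give that end degree at least two. *)
Lemma degL_indicator_uniq n m (w : {ffun 'I_n * 'I_m -> nat}) B i j k :
  degL w = indicator B -> 0 < w (i, j) -> 0 < w (i, k) -> j = k.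
Proof.
move=> dLw wj wk; apply/eqP; apply: contraT => njk.
have := congr1 (fun v : vec n => v i) dLw; rewrite !ffunE.
rewrite (bigD1 j) //= (bigD1 k) 1?eq_sym //= => sumE.
have: 2 <= (i \in B) by rewrite -sumE addnA; apply: leq_trans (leq_add wj wk) (leq_addr _ _).
by case: (i \in B).
Qed.

Lemma degL_indicator_mem n m (w : {ffun 'I_n * 'I_m -> nat}) B i j :
  degL w = indicator B -> 0 < w (i, j) -> i \in B.
Proof.
move=> dLw wj; have := congr1 (fun v : vec n => v i) dLw.
by rewrite !ffunE (bigD1 j) //=; case: (i \in B) => //; case: (w (i, j)) wj.
Qed.

Lemma degR_gt0 n m (w : {ffun 'I_n * 'I_m -> nat}) j :
  reflect (exists i, 0 < w (i, j)) (0 < degR w j).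
Proof.
rewrite ffunE lt0n sum_nat_eq0 negb_forall.
by apply: (iffP existsP) => -[i wi]; exists i; move: wi; rewrite lt0n.
Qed.

(** Every left vertex carries at most one unit of w, so any choice of one
    positive edge at each vertex of the support is a matching, and its left
    end lies in the basis whose indicator is [degL w]. *)
Lemma truncation_induced_indep n m (G : bigraph n m) (M : matroid 'I_n) v :
  truncation (ones m) (induction G (basis_vectors M)) v ->
  exists2 X, v = indicator X & induced_indep G M X.
Proof.
case=> a [w [w0 [B basisB dLw] ->] ->]; rewrite truncate_ones.
set X := [set j | _]; exists X => //.
(* The pick keeps one edge of positive weight at each vertex of X, so that F
   is injective on right ends. *)
pose F := [set e : 'I_n * 'I_m |
  (e.2 \in X) && ([pick i | 0 < w (i, e.2)] == Some e.1)].
have Fw i j : (i, j) \in F -> 0 < w (i, j).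
  rewrite inE /= => /andP[_].
  by case: pickP => // i' wi' /eqP[<-].
apply/existsP; exists F; apply/and3P; split.
- apply/matchingP; split.
  + apply/fintype.subsetP => -[i j] /Fw wij.
    by apply: contraLR wij => /w0 ->.
  + move=> [i j] [i' k] /Fw wj /Fw wk /= ii'; rewrite -{}ii' in wk *.
    by rewrite (degL_indicator_uniq dLw wj wk).
  + move=> [i j] [i' k]; rewrite !inE /= => /andP[_ /eqP pj] /andP[_ /eqP pk] jk.
    by move: pj; rewrite jk pk => -[->].
- apply/eqP/setP => j; apply/imsetP/idP => [[e] | jX].
    by rewrite inE => /andP[eX _] ->.
  have /degR_gt0[i0 wi0] : 0 < degR w j by rewrite inE in jX.
  case pickE: [pick i | 0 < w (i, j)] => [i|].
    by exists (i, j); rewrite // inE jX /= pickE.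
  by move: pickE; case: pickP => // /(_ i0); rewrite wi0.
apply: (indepS _ (maxsetp basisB)).
apply/fintype.subsetP => _ /imsetP[[i j] /Fw wij ->].
exact: degL_indicator_mem dLw wij.
Qed.

(** The left end of a matching witnessing the independence of X need not be a
    basis.  Once it is extended to a basis, each added vertex must send its unit
    somewhere; this can enlarge the support but not remove X from it. *)
Lemma induced_indep_sub_truncation n m (G : bigraph n m) (M : matroid 'I_n) X :
  left_nbrs G [set: 'I_m] = [set: 'I_n] -> induced_indep G M X ->
  exists2 Y : {set 'I_m}, X \subset Y &
    truncation (ones m) (induction G (basis_vectors M)) (indicator Y).
Proof.
move=> nbrG /existsP[F /and3P[/matchingP[sFG F1 _] /eqP <- iF]].
have [B basisB sFB] := maxset_exists iF.
(* f sends each left vertex along its matching edge if it has one, and along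
   an arbitrary edge otherwise. *)
have /fin_all_exists[f fP] (i : 'I_n) :
    exists j, (i, j) \in G /\ (forall k, (i, k) \in F -> k = j).
  have [/imsetP[[i' j] eF /= ->] | iF'] := boolP (i \in fst @: F).
    exists j; split=> [|k kF]; first exact: (fintype.subsetP sFG).
    by have [] := F1 _ _ kF eF erefl.
  have: i \in left_nbrs G [set: 'I_m] by rewrite nbrG inE.
  rewrite inE => /exists_inP[j _ ijG]; exists j; split=> // k kF.
  by case/negP: iF'; apply/imsetP; exists (i, k).
pose w := [ffun e : 'I_n * 'I_m => ((e.1 \in B) && (f e.1 == e.2) : nat)].
exists [set j | 0 < degR w j].
  apply/fintype.subsetP => _ /imsetP[[i j] eF ->]; rewrite inE /=.
  apply/degR_gt0; exists i; rewrite ffunE /= -((fP i).2 j eF) eqxx andbT.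
  by rewrite (fintype.subsetP sFB) //; apply/imsetP; exists (i, j).
exists (degR w); last by rewrite truncate_ones.
exists w; split=> //.
  move=> [i j] nG; rewrite ffunE /=; case: eqP => [fij | _]; last by rewrite andbF.
  by rewrite -fij (fP i).1 in nG.
exists B => //; apply/ffunP => i; rewrite !ffunE (bigD1 (f i)) //= ffunE /= eqxx andbT.
by rewrite big1 ?addn0 // => j nj; rewrite ffunE /= eq_sym (negPf nj) andbF.
Qed.

Unset Implicit Arguments.
Set Strict Implicit.

Theorem corollary4p20 (n m : nat) (G : bigraph n m) (M : matroid 'I_n) :
  left_nbrs G [set: 'I_m]%SET = [set: 'I_n]%SET ->
  basis_vectors (induced_matroid G M) =
    retract (ones m) (induction G (basis_vectors M)).
Proof.
move=> nbrG; apply/seteqP; split=> v.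
  case=> X /maxsetP[/= iX maxX] ->.
  have [Y sXY tY] := induced_indep_sub_truncation nbrG iX.
  have [Z /indicator_inj YZ iZ] := truncation_induced_indep tY.
  rewrite -{Z}YZ in iZ; rewrite (maxX _ iZ sXY) in tY; split=> // u tu.
  have [Z -> {}iZ] := truncation_induced_indep tu.
  by rewrite vle_indicator => /(maxX _ iZ) ->.
case=> tv maxv; have [X vX iX] := truncation_induced_indep tv.
exists X => //; apply/maxsetP; split=> //= Y iY sXY.
have [Z sYZ tZ] := induced_indep_sub_truncation nbrG iY.
have sXZ := fintype.subset_trans sXY sYZ.
have /indicator_inj ZX : indicator Z = indicator X.
  by rewrite -vX; apply: maxv; rewrite // vX vle_indicator.
by apply/eqP; rewrite finset.eqEsubset sXY -{1}ZX sYZ.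
Qed.
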